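(* The optimization problem $$\min_{(L,S)\in\mathscr D}\ F(L,S)=f(L,S)+C\|S\|_0$$ admits a solution in $\mathscr D$ (i.e. $F$ attains its minimum over $\mathscr D$), and the set of all its minimizers is bounded.
   Context: Fix a positive integer $p$, real parameters $C>0$ and $\mu>0$, and a real symmetric positive definite matrix $\check\Sigma\in\mathbb R^{p\times p}$ (the sample covariance matrix). All matrices $L,S$ are real symmetric of size $p\times p$; $\succeq 0$ means positive semidefinite and $\succ 0$ means positive definite. The feasible set is $$\mathscr D:=\{(L,S): L\succeq 0,\ S\succeq 0,\ L+S\succ 0\}.$$ The function $f$ is $$f(L,S):=\operatorname{tr}(L)+\mu\{\operatorname{tr}[(L+S)\check\Sigma^{-1}]-\log\det(L+S)\}.$$ $\|S\|_0$ denotes the number of nonzero entries of $S$. *)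

(* Defs.v *)
From HB Require Import structures.
From mathcomp Require Import all_boot all_order all_algebra.
From mathcomp Require Import all_classical all_reals all_analysis.

Set Implicit Arguments.
Unset Strict Implicit.
Unset Printing Implicit Defensive.

Import Order.TTheory GRing.Theory Num.Theory.
Import numFieldNormedType.Exports.

Local Open Scope classical_set_scope.
Local Open Scope ring_scope.

Definition psdmx (R : realType) (p : nat) (A : 'M[R]_p) : Prop :=
  A \is symmetricmx /\ forall x : 'cV[R]_p, 0 <= (x^T *m A *m x) 0 0.

Definition pdmx (R : realType) (p : nat) (A : 'M[R]_p) : Prop :=
  A \is symmetricmx /\
  forall x : 'cV[R]_p, x != 0 -> 0 < (x^T *m A *m x) 0 0.

(* All p^2 positions are counted, diagonal ones included, so that each nonzero
   off-diagonal pair of the symmetric matrix contributes 2. *)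
Definition l0norm (R : realType) (p : nat) (S : 'M[R]_p) : nat :=
  #|[pred ij : 'I_p * 'I_p | S ij.1 ij.2 != 0]|.

Definition feasible (R : realType) (p : nat) : set ('M[R]_p * 'M[R]_p) :=
  [set LS | [/\ psdmx LS.1, psdmx LS.2 & pdmx (LS.1 + LS.2)]].

(* [ln] and [invmx] take junk values outside their domain; for feasible LS and
   positive definite Sigma the determinant is positive and Sigma invertible. *)
Definition fobj (R : realType) (p : nat) (mu : R) (Sigma : 'M[R]_p)
    (LS : 'M[R]_p * 'M[R]_p) : R :=
  \tr LS.1 + mu * (\tr ((LS.1 + LS.2) *m invmx Sigma)
                   - ln (\det (LS.1 + LS.2))).

Definition Fobj (R : realType) (p : nat) (C mu : R) (Sigma : 'M[R]_p)
    (LS : 'M[R]_p * 'M[R]_p) : R :=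
  fobj mu Sigma LS + C * (l0norm LS.2)%:R.

Definition minimizers (R : realType) (T : Type) (D : set T) (F : T -> R) :
    set T :=
  [set x | D x /\ forall y, D y -> F x <= F y].

(* Main.v *)
(* With t = tr (L + S), the trace term dominates t / tr Sigma, by Cauchy-Schwarz
   for the form Sigma, while the entries of a positive semidefinite matrix are
   at most its trace, so that log det (L + S) is at most log p! + p log t. Hence
   F is coercive; since F <= c also forces det (L + S) >= exp (- c / mu), a
   sublevel set of F lies in a compact set of feasible pairs. On that compact
   set the l0 term is handled by fixing the zero pattern of S, of which there
   are finitely many. *)
Require Import Defs.
From HB Require Import structures.
From mathcomp Require Import all_boot all_order all_algebra.
From mathcomp Require Import all_classical all_reals all_analysis.
From mathcomp Require Import perm ring lra.
Import Order.TTheory GRing.Theory Num.Theory.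
Import numFieldNormedType.Exports.
Local Open Scope classical_set_scope.
Local Open Scope ring_scope.

(** * Matrices as bilinear forms, outer products *)

Definition bil {R : realType} {p : nat} (A : 'M[R]_p) (x y : 'cV[R]_p) : R :=
  (x^T *m A *m y) 0 0.

Lemma symmetricmxP {R : realType} {p : nat} {A : 'M[R]_p} :
  A \is symmetricmx <-> A^T = A.
Proof.
rewrite is_hermitianmxE expr0 scale1r map_mx_id //.
by split=> [/eqP <-|->].
Qed.

Section Bilinear.
Set Implicit Arguments.
Unset Strict Implicit.
Context {R : realType} {p : nat}.
Implicit Types (A B : 'M[R]_p) (x y v w : 'cV[R]_p).

Lemma bilC A x y : A^T = A -> bil A x y = bil A y x.
Proof.
move=> sA; rewrite /bil -[in LHS](trmxK (x^T *m A *m y)) mxE.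
by rewrite !trmx_mul trmxK sA mulmxA.
Qed.

Lemma bilDl A x x' y : bil A (x + x') y = bil A x y + bil A x' y.
Proof. by rewrite /bil linearD !mulmxDl mxE. Qed.

Lemma bilDr A x y y' : bil A x (y + y') = bil A x y + bil A x y'.
Proof. by rewrite /bil mulmxDr mxE. Qed.

Lemma bilZl A a x y : bil A (a *: x) y = a * bil A x y.
Proof. by rewrite /bil linearZ -!scalemxAl mxE. Qed.

Lemma bilZr A a x y : bil A x (a *: y) = a * bil A x y.
Proof. by rewrite /bil -scalemxAr mxE. Qed.

Lemma bil0 x y : bil 0 x y = 0.
Proof. by rewrite /bil mulmx0 mul0mx mxE. Qed.

Lemma bilDm A B x y : bil (A + B) x y = bil A x y + bil B x y.
Proof. by rewrite /bil mulmxDr mulmxDl mxE. Qed.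

Lemma bilZm a A x y : bil (a *: A) x y = a * bil A x y.
Proof. by rewrite /bil -scalemxAr -scalemxAl mxE. Qed.

Lemma bilE A x y : bil A x y = \sum_i x i 0 * (A *m y) i 0.
Proof. by rewrite /bil -mulmxA mxE; apply: eq_bigr => i _; rewrite mxE. Qed.

Lemma bil_deltal A i x : bil A (delta_mx i 0) x = (A *m x) i 0.
Proof. by rewrite /bil trmx_delta -mulmxA -rowE mxE. Qed.

Lemma bil_delta A i j : bil A (delta_mx i 0) (delta_mx j 0) = A i j.
Proof. by rewrite bil_deltal -colE mxE. Qed.

Lemma bil_outer v x y : bil (v *m v^T) x y = bil 1%:M v x * bil 1%:M v y.
Proof.
rewrite (bilC v x) ?trmx1 // /bil !mulmx1 mulmxA -mulmxA.
by rewrite [LHS]mxE big_ord1.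
Qed.

Lemma tr_outer v : \tr (v *m v^T) = bil 1%:M v v.
Proof. by rewrite mxtrace_mulC /bil mulmx1 /mxtrace big_ord1. Qed.

Lemma bil1_ge0 v : 0 <= bil 1%:M v v.
Proof. by rewrite bilE sumr_ge0 // => i _; rewrite mul1mx -expr2 sqr_ge0. Qed.

Lemma bil1_gt0 v : v != 0 -> 0 < bil 1%:M v v.
Proof.
move=> v0; rewrite lt_neqAle bil1_ge0 andbT eq_sym bilE.
apply: contra v0; rewrite psumr_eq0 => [|i _]; last first.
  by rewrite mul1mx -expr2 sqr_ge0.
move=> /allP h; apply/eqP/colP => i; rewrite [RHS]mxE.
by have := h i (mem_index_enum _); rewrite mul1mx mulf_eq0 orbb => /eqP.
Qed.

(** * Positive semidefinite and positive definite matrices *)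

Lemma psdmx_sym A : psdmx A -> A^T = A.
Proof. by case=> /symmetricmxP. Qed.

Lemma psdmx_ge0 A x : psdmx A -> 0 <= bil A x x.
Proof. by case=> _ /(_ x). Qed.

Lemma pdmx_psd A : pdmx A -> psdmx A.
Proof.
case=> sA pA; split=> // x; have [->|/pA/ltW//] := eqVneq x 0.
by rewrite mulmx0 mxE.
Qed.

Lemma psdmx1 : psdmx (1%:M : 'M[R]_p).
Proof. by split; [apply/symmetricmxP; rewrite trmx1|exact: bil1_ge0]. Qed.

Lemma psdmx0 : psdmx (0 : 'M[R]_p).
Proof.
by split=> [|x]; [apply/symmetricmxP; rewrite trmx0|rewrite -/(bil 0 x x) bil0].
Qed.

Lemma psdmxD A B : psdmx A -> psdmx B -> psdmx (A + B).
Proof.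
move=> pA pB; split=> [|x].
  by apply/symmetricmxP; rewrite linearD /= !psdmx_sym.
by rewrite -/(bil _ _ _) bilDm addr_ge0 // psdmx_ge0.
Qed.

(** The value of the form at [x + t *: y] is a quadratic polynomial in [t] that is never
    negative. *)
Lemma psdmx_CauchySchwarz A x y :
  psdmx A -> bil A x y ^+ 2 <= bil A x x * bil A y y.
Proof.
move=> pA; have sA := psdmx_sym pA.
have q t : 0 <= bil A x x + 2 * t * bil A x y + t ^+ 2 * bil A y y.
  have := psdmx_ge0 (x + t *: y) pA.
  rewrite !(bilDl, bilDr, bilZl, bilZr) (bilC y x sA).
  by congr (_ <= _); ring.
have a0 := psdmx_ge0 x pA; have := psdmx_ge0 y pA.
move: q a0; set a := bil A x x; set b := bil A x y; set c := bil A y y.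
move=> q a0; rewrite le_eqVlt => /predU1P[c0|c0].
  suff -> : b = 0 by rewrite expr0n mulr_ge0 // -c0.
  (* With [c = 0] the polynomial is affine in [t]; if [b] were nonzero, this [t] would give it the
     value -1. *)
  have [//|b0] := eqVneq b 0; have := q (- (a + 1) / (2 * b)).
  rewrite -c0 mulr0 addr0.
  have -> : a + 2 * (- (a + 1) / (2 * b)) * b = -1 by field.
  by rewrite ler0N1.
(* The minimizer of the polynomial when [c > 0]. *)
have := q (- b / c).
have -> : a + 2 * (- b / c) * b + (- b / c) ^+ 2 * c = (a * c - b ^+ 2) / c.
  by field; rewrite gt_eqF.
by rewrite pmulr_lge0 ?invr_gt0 // subr_ge0.
Qed.

Lemma psdmx_diag_ge0 A i : psdmx A -> 0 <= A i i.
Proof. by move=> /(psdmx_ge0 (delta_mx i 0)); rewrite bil_delta. Qed.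

Lemma psdmx_diag_le_tr A i : psdmx A -> A i i <= \tr A.
Proof.
move=> pA; rewrite /mxtrace (bigD1 i) //= lerDl sumr_ge0 // => j _.
exact: psdmx_diag_ge0.
Qed.

Lemma psdmx_tr_ge0 A : psdmx A -> 0 <= \tr A.
Proof. by move=> pA; apply: sumr_ge0 => i _; exact: psdmx_diag_ge0. Qed.

Lemma psdmx_entry_sqr A i j : psdmx A -> A i j ^+ 2 <= A i i * A j j.
Proof.
move=> /(psdmx_CauchySchwarz (delta_mx i 0) (delta_mx j 0)).
by rewrite !bil_delta.
Qed.

Lemma psdmx_entry_le_tr A i j : psdmx A -> `|A i j| <= \tr A.
Proof.
move=> pA; rewrite -(@ler_pXn2r _ 2) ?nnegrE ?psdmx_tr_ge0 //.
rewrite real_normK ?num_real // (le_trans (psdmx_entry_sqr i j pA)) // expr2.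
by rewrite ler_pM ?psdmx_diag_ge0 ?psdmx_diag_le_tr.
Qed.

(** Cauchy-Schwarz between [x] and each basis vector makes every entry of [A *m x] vanish. *)
Lemma psdmx_ker A x : psdmx A -> bil A x x = 0 -> A *m x = 0.
Proof.
move=> pA x0; apply/colP => i; rewrite [RHS]mxE -bil_deltal; apply/eqP.
rewrite -sqrf_eq0 eq_le sqr_ge0 andbT.
by have := psdmx_CauchySchwarz (delta_mx i 0) x pA; rewrite x0 mulr0.
Qed.

Lemma pdmx_unit A : pdmx A -> A \in unitmx.
Proof.
case=> _ pA; rewrite unitmxE unitfE; apply/det0P => -[v v0 vA].
have := pA v^T; rewrite trmxK vA mul0mx mxE ltxx.
move/(_ _)/notF; apply; apply: contra v0 => /eqP e.
by rewrite -(trmxK v) e trmx0.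
Qed.

(** An isotropic vector lies in the kernel, which is trivial here. This lets a closed condition on
    the determinant replace the open condition of definiteness. *)
Lemma psdmx_det_pd A : psdmx A -> \det A != 0 -> pdmx A.
Proof.
move=> pA dA; split=> [|x x0]; first by case: pA.
rewrite -/(bil A x x) lt_neqAle psdmx_ge0 // andbT eq_sym.
apply: contra x0 => /eqP /(psdmx_ker pA) Ax.
have uA : A \in unitmx by rewrite unitmxE unitfE.
by rewrite -(mulKmx uA x) Ax mulmx0.
Qed.

(* Subtracting the outer product of the [i]-th column divided by [A i i] keeps
   the matrix positive semidefinite and kills its [i]-th diagonal entry. *)
Lemma psdmx_sum_outer A :
  psdmx A -> exists s : seq 'cV[R]_p, A = \sum_(v <- s) v *m v^T.
Proof.
have [n] := ubnP #|[pred i | A i i != 0]|.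
elim: n A => // n IH A; rewrite ltnS => cA pA; have sA := psdmx_sym pA.
have [/existsP[i Ai]|/existsPn A0] := boolP [exists i, A i i != 0]; last first.
  exists [::]; rewrite big_nil; apply/matrixP => i j; rewrite [RHS]mxE.
  apply/eqP; rewrite -sqrf_eq0 eq_le sqr_ge0 andbT.
  have := psdmx_entry_sqr i j pA.
  by have /negPn/eqP -> := A0 i; rewrite mul0r.
have Ai0 : 0 < A i i by rewrite lt_neqAle eq_sym Ai psdmx_diag_ge0.
pose c := col i A; pose B := A - (A i i)^-1 *: (c *m c^T).
have cE x : bil 1%:M c x = bil A (delta_mx i 0) x.
  by rewrite /bil mulmx1 /c colE trmx_mul sA.
have BE x y : bil B x y = bil A x y -
    (A i i)^-1 * (bil A (delta_mx i 0) x * bil A (delta_mx i 0) y).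
  by rewrite /B bilDm -scaleNr bilZm mulNr bil_outer !cE.
have pB : psdmx B.
  split=> [|x].
    apply/symmetricmxP; rewrite /B linearB linearZ /= trmx_mul trmxK.
    by rewrite -/(c) sA.
  rewrite -/(bil B x x) BE subr_ge0 ler_pdivrMl // -bil_delta -expr2.
  exact: psdmx_CauchySchwarz.
have Bii j : B j j = A j j - (A i i)^-1 * A i j ^+ 2.
  by rewrite -[LHS]bil_delta BE !bil_delta expr2.
case: (IH B _ pB) => [|s Bs].
  (* The induction is on the number of nonzero diagonal entries. If [A j j = 0] then [A i j = 0], so
     zero diagonal entries of [A] stay zero in [B], and the [i]-th becomes zero as well. *)
  apply: leq_trans cA; apply: proper_card; apply/fintype.properP; split.
    apply/fintype.subsetP => j; rewrite !inE Bii; apply: contra => /eqP Aj.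
    have := psdmx_entry_sqr i j pA; rewrite Aj mulr0 => h.
    have /eqP -> : A i j ^+ 2 == 0 by rewrite eq_le h sqr_ge0.
    by rewrite mulr0 subr0.
  by exists i; rewrite !inE // Bii expr2 mulrA mulVf // mul1r subrr eqxx.
exists ((Num.sqrt (A i i))^-1 *: c :: s); rewrite big_cons -Bs /B.
rewrite linearZ /= -scalemxAr -scalemxAl scalerA -invfM -expr2.
by rewrite sqr_sqrtr ?ltW // addrC subrK.
Qed.

(** Both sides are additive in [A], so the decomposition into outer products reduces the claim to
    Cauchy-Schwarz for the identity form. It bounds the form by the trace without any spectral
    theory. *)
Lemma psdmx_bil_le_tr A v : psdmx A -> bil A v v <= \tr A * bil 1%:M v v.
Proof.
case/psdmx_sum_outer=> s ->; rewrite raddf_sum mulr_suml /=.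
elim: s => [|w s IH]; first by rewrite !big_nil bil0.
rewrite !big_cons bilDm lerD // bil_outer tr_outer -expr2.
exact: psdmx_CauchySchwarz psdmx1.
Qed.

(** * Trace inequalities for the inverse *)

Lemma pdmx_inv_bil_ge0 A v : pdmx A -> 0 <= bil (invmx A) v v.
Proof.
move=> pA; have uA := pdmx_unit pA; have sA := psdmx_sym (pdmx_psd pA).
have := psdmx_ge0 (invmx A *m v) (pdmx_psd pA).
by rewrite /bil trmx_mul trmx_inv sA -!mulmxA mulKVmx // mulmxA.
Qed.

(** Since [v^T v] is the form [A] at [invmx A *m v] and [v], Cauchy-Schwarz bounds its square by
    [bil (invmx A) v v * bil A v v]. Bounding the last factor by [\tr A * v^T v] and cancelling
    [v^T v] gives the claim. *)
Lemma pdmx_inv_bil_ge A v :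
  pdmx A -> bil 1%:M v v <= \tr A * bil (invmx A) v v.
Proof.
move=> pA; have uA := pdmx_unit pA; have sA := psdmx_sym (pdmx_psd pA).
have [->|v0] := eqVneq v 0; first by rewrite /bil !mulmx0 mxE mulr0.
have v1 := bil1_gt0 v0; rewrite -(ler_pM2r v1) -expr2.
have -> : bil 1%:M v v = bil A (invmx A *m v) v.
  by rewrite /bil trmx_mul trmx_inv sA -!mulmxA mulKmx // mul1mx.
have := psdmx_CauchySchwarz (invmx A *m v) v (pdmx_psd pA).
move/le_trans; apply.
have -> : bil A (invmx A *m v) (invmx A *m v) = bil (invmx A) v v.
  by rewrite /bil trmx_mul trmx_inv sA -!mulmxA mulKVmx // mulmxA.
have -> : bil A (invmx A *m v) v = bil 1%:M v v.
  by rewrite /bil trmx_mul trmx_inv sA -!mulmxA mulKmx // mul1mx.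
rewrite mulrAC mulrC ler_wpM2r ?pdmx_inv_bil_ge0 //.
exact/psdmx_bil_le_tr/pdmx_psd.
Qed.

(** Writing [B] as a sum of outer products [v *m v^T] reduces this to the preceding bound for each
    [v]. *)
Lemma tr_le_tr_inv A B :
  pdmx A -> psdmx B -> \tr B <= \tr A * \tr (B *m invmx A).
Proof.
move=> pA /psdmx_sum_outer[s ->]; rewrite mulmx_suml !raddf_sum mulr_sumr /=.
apply: ler_sum => v _; rewrite tr_outer -mulmxA mxtrace_mulC.
by rewrite [\tr (_ *m _ *m _)]/mxtrace big_ord1 pdmx_inv_bil_ge.
Qed.

Lemma pdmx_tr_gt0 A : (0 < p)%N -> pdmx A -> 0 < \tr A.
Proof.
move=> p0 pA; pose i := Ordinal p0.
apply: lt_le_trans (psdmx_diag_le_tr i (pdmx_psd pA)).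
rewrite -bil_delta; case: pA => _; apply.
by apply/eqP => /colP/(_ i)/eqP; rewrite !mxE !eqxx oner_eq0.
Qed.

End Bilinear.

(** The Leibniz formula has [p!] terms, each of absolute value at most [t ^+ p]. *)
Lemma det_le {R : realType} {p : nat} (A : 'M[R]_p) (t : R) :
  (forall i j, `|A i j| <= t) -> `|\det A| <= p`!%:R * t ^+ p.
Proof.
move=> At; rewrite /determinant (le_trans (ler_norm_sum _ _ _)) //.
have -> : p`!%:R * t ^+ p = \sum_(s : 'S_p) t ^+ p.
  by rewrite sumr_const card_Sn mulr_natl.
apply: ler_sum => s _; rewrite normrM normrX normrN1 expr1n mul1r normr_prod.
rewrite -[X in t ^+ X](card_ord p) -prodr_const; apply: ler_prod => i _.
by rewrite normr_ge0 At.
Qed.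

(** * Continuity of matrix expressions, compact boxes, sign of the determinant *)

Section Continuity.
Context {R : realType}.
Set Implicit Arguments.
Unset Strict Implicit.

Lemma continuous_sum (T : topologicalType) (I : Type) (s : seq I) (P : pred I)
    (f : I -> T -> R) :
  (forall i, P i -> continuous (f i)) ->
  continuous (fun x => \sum_(i <- s | P i) f i x).
Proof.
by move=> cf x; apply: cvg_big => [|i Pi]; [exact: add_continuous|exact: cf].
Qed.

Lemma continuous_prod (T : topologicalType) (I : Type) (s : seq I) (P : pred I)
    (f : I -> T -> R) :
  (forall i, P i -> continuous (f i)) ->
  continuous (fun x => \prod_(i <- s | P i) f i x).
Proof.
by move=> cf x; apply: cvg_big => [|i Pi]; [exact: mul_continuous|exact: cf].
Qed.

Lemma continuous_mx (T : topologicalType) (m n : nat) (f : T -> 'M[R]_(m, n)) :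
  (forall i j, continuous (fun x => f x i j)) -> continuous f.
Proof.
move=> cf x; apply/cvg_ballP => e e0.
(* Balls of matrices are entrywise, and finitely many neighbourhoods intersect in a
   neighbourhood. *)
have h : \forall y \near x, forall ij : 'I_m * 'I_n,
    ball (f x ij.1 ij.2) e (f y ij.1 ij.2).
  apply: filter_forall => -[i j] /=.
  exact: (cvg_ball (cf i j x)).
by near=> y; split=> // i j; have := near h y; move/(_ _ (i, j)); apply.
Unshelve. all: by end_near. Qed.

Lemma continuous_det (T : topologicalType) (n : nat) (f : T -> 'M[R]_n) :
  (forall i j, continuous (fun x => f x i j)) ->
  continuous (fun x => \det (f x)).
Proof.
move=> cf; apply: continuous_sum => s _ x; apply: cvgMl_tmp.
by apply: continuous_prod => i _; exact: cf.
Qed.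

Lemma continuous_tr_mulr (T : topologicalType) (n : nat) (f : T -> 'M[R]_n)
    (B : 'M[R]_n) :
  (forall i j, continuous (fun x => f x i j)) ->
  continuous (fun x => \tr (f x *m B)).
Proof.
move=> cf; apply: continuous_sum => i _.
under [X in continuous X]eq_fun do rewrite mxE.
by apply: continuous_sum => j _ x; apply: cvgMr_tmp; exact: cf.
Qed.

Lemma continuous_bil (T : topologicalType) (n : nat) (f : T -> 'M[R]_n)
    (v w : 'cV[R]_n) :
  (forall i j, continuous (fun x => f x i j)) ->
  continuous (fun x => bil (f x) v w).
Proof.
move=> cf.
under [X in continuous X]eq_fun do rewrite bilE.
apply: continuous_sum => i _ x; apply: cvgMl_tmp; move: x.
under [X in continuous X]eq_fun do rewrite mxE.
by apply: continuous_sum => j _ x; apply: cvgMr_tmp; exact: cf.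
Qed.

(** The box is the continuous image under [vec_mx] of a product of segments. *)
Lemma compact_mx_box (m n : nat) (M : R) :
  compact [set A : 'M[R]_(m, n) | forall i j, `|A i j| <= M].
Proof.
have cB : compact [set v : 'rV[R]_(m * n) | forall i, v ord0 i \in `[- M, M]].
  apply: (@rV_compact _ _ (fun=> `[- M, M]%classic)) => i.
  exact: segment_compact.
have -> : [set A : 'M[R]_(m, n) | forall i j, `|A i j| <= M] =
    vec_mx @` [set v : 'rV[R]_(m * n) | forall i, v ord0 i \in `[- M, M]].
  apply/seteqP; split=> [A AM|_ [v vM <-] i j].
    exists (mxvec A); last exact: mxvecK.
    move=> k /=; case/mxvec_indexP: k => i j.
    by rewrite mxvecE in_itv /= -ler_norml.
  by have := vM (mxvec_index i j); rewrite /= mxE in_itv /= -ler_norml.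
apply: continuous_compact cB; apply: continuous_subspaceT.
apply: continuous_mx => i j.
under [X in continuous X]eq_fun do rewrite mxE.
exact: coord_continuous.
Qed.

(* The determinant does not vanish on the segment from the identity to [A]. *)
Lemma pdmx_det_gt0 (n : nat) (A : 'M[R]_n) : pdmx A -> 0 < \det A.
Proof.
move=> pA; pose g (t : R) := \det (1%:M + t *: (A - 1%:M)).
have g0 t : 0 <= t <= 1 -> g t != 0.
  move=> /andP[t0 t1]; rewrite /g.
  have -> : 1%:M + t *: (A - 1%:M) = (1 - t)%:M + t *: A.
    by rewrite scalerBr scale_scalar_mx mulr1 addrCA -raddfB addrC.
  apply/det0P => -[v v0 vA].
  have /eqP : bil ((1 - t)%:M + t *: A) v^T v^T = 0.
    by rewrite /bil trmxK vA mul0mx mxE.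
  have vT0 : v^T != 0.
    by apply: contra v0 => /eqP e; rewrite -(trmxK v) e trmx0.
  (* The form at [v^T] is a convex combination of two positive numbers, hence nonzero. *)
  rewrite bilDm -scalemx1 !bilZm gt_eqF //.
  have Av : 0 < bil A v^T v^T by case: pA => _; exact.
  have Iv := bil1_gt0 vT0.
  by nra.
have cg : continuous g.
  apply: continuous_det => i j.
  under [X in continuous X]eq_fun do rewrite !mxE.
  by move=> x; apply: cvgD; [exact: cvg_cst|apply: cvgMr_tmp; exact: cvg_id].
have g1E : g 1 = \det A by rewrite /g scale1r addrC subrK.
have g0E : g 0 = 1 by rewrite /g scale0r addr0 det1.
rewrite ltNge; apply/negP => dA.
have [||c] := @IVT R g 0 1 0 ler01.
- exact: continuous_subspaceT.
- by rewrite g0E g1E ge_min dA orbT le_max ler01.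
by rewrite in_itv /= => /g0 /eqP.
Qed.

End Continuity.

(** * Lower bounds for the objective *)

Section Minimization.
Context {R : realType} {p : nat}.
Set Implicit Arguments.
Unset Strict Implicit.
Implicit Types (LS : 'M[R]_p * 'M[R]_p) (Sigma : 'M[R]_p).

(** This is [ln y <= y - 1] at [y = a * x], weakened by 1. The slope [a] stays free so that it can
    be taken small later. *)
Lemma ln_le_affine (a x : R) : 0 < a -> 0 < x -> ln x <= a * x - ln a.
Proof.
move=> a0 x0; rewrite lerBrDr addrC -lnM ?posrE //.
have ax0 : 0 < a * x by exact: mulr_gt0.
have -> : ln (a * x) = ln (1 + (a * x - 1)) by rewrite addrC subrK.
by apply: (le_trans (le_ln1Dx _)); lra.
Qed.

Lemma ln_det_le (A : 'M[R]_p) (a : R) : 0 < a -> (0 < p)%N -> pdmx A ->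
  ln (\det A) <= ln p`!%:R + p%:R * (a * \tr A - ln a).
Proof.
move=> a0 p0 pA; have trA := pdmx_tr_gt0 p0 pA.
have fp : 0 < p`!%:R :> R by rewrite ltr0n fact_gt0.
have dA := det_le (fun i j => psdmx_entry_le_tr i j (pdmx_psd pA)).
apply: (@le_trans _ _ (ln (p`!%:R * \tr A ^+ p))).
  rewrite ler_ln ?posrE ?pdmx_det_gt0 ?mulr_gt0 ?exprn_gt0 //.
  exact: le_trans (ler_norm _) dA.
rewrite lnM ?posrE ?exprn_gt0 // lerD2l lnXn // -[ln _ *+ p]mulr_natl.
by rewrite ler_wpM2l // ln_le_affine.
Qed.

Lemma fobj_ge_trace mu Sigma : (0 < p)%N -> 0 < mu -> pdmx Sigma ->
  exists K, forall LS, feasible LS ->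
    mu / (2 * \tr Sigma) * \tr (LS.1 + LS.2) - K <= fobj mu Sigma LS.
Proof.
move=> p0 mu0 pS; have s0 := pdmx_tr_gt0 p0 pS.
(* With this slope the bound on the log-determinant uses up exactly half of [\tr X / \tr Sigma]; the
   other half gives coercivity. *)
pose a := (2 * p%:R * \tr Sigma)^-1.
have pR : 0 < p%:R :> R by rewrite ltr0n.
have a0 : 0 < a by rewrite invr_gt0 !mulr_gt0.
exists (mu * (ln p`!%:R - p%:R * ln a)) => LS [pL pS2 pX].
have := ln_det_le a0 p0 pX; have := tr_le_tr_inv pS (pdmx_psd pX).
rewrite /fobj; have := psdmx_tr_ge0 pL; set X := LS.1 + LS.2.
set q := \tr (X *m _) => L0 Xq Xln.
have {}Xq : \tr X / \tr Sigma <= q by rewrite ler_pdivrMr // mulrC.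
have pa : p%:R * (a * \tr X) = \tr X / \tr Sigma / 2.
  by rewrite /a; field; rewrite !gt_eqF.
have -> : mu / (2 * \tr Sigma) * \tr X - mu * (ln p`!%:R - p%:R * ln a) =
   mu * (\tr X / \tr Sigma / 2 - (ln p`!%:R - p%:R * ln a)).
  by field; rewrite gt_eqF.
rewrite mulrBr pa in Xln.
by apply: ler_wpDl => //; rewrite ler_pM2l //; lra.
Qed.

Lemma fobj_ge_ln_det mu Sigma LS : (0 < p)%N -> 0 < mu -> pdmx Sigma ->
  feasible LS -> - mu * ln (\det (LS.1 + LS.2)) <= fobj mu Sigma LS.
Proof.
move=> p0 mu0 pS [pL _ pX]; have := tr_le_tr_inv pS (pdmx_psd pX).
have := psdmx_tr_ge0 (pdmx_psd pX); rewrite /fobj; have := psdmx_tr_ge0 pL.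
set X := LS.1 + LS.2; set q := \tr (X *m _) => L0 X0 Xq.
have q0 : 0 <= q.
  by rewrite -(pmulr_rge0 _ (pdmx_tr_gt0 p0 pS)) (le_trans X0).
by apply: ler_wpDl => //; rewrite mulNr -mulrN ler_pM2l // lerDr.
Qed.

Lemma fobj_le_Fobj (C mu : R) Sigma LS :
  0 < C -> fobj mu Sigma LS <= Fobj C mu Sigma LS.
Proof. by move=> C0; rewrite lerDl mulr_ge0 // ltW. Qed.

(** * Continuity, closedness and penalized minimization on pairs of matrices *)

Lemma fst_entry_continuous i j :
  continuous (fun LS : 'M[R]_p * 'M[R]_p => LS.1 i j).
Proof.
move=> LS; apply: (@continuous_comp _ _ _ fst (fun A : 'M[R]_p => A i j)).
  exact: cvg_fst.
exact: coord_continuous.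
Qed.

Lemma snd_entry_continuous i j :
  continuous (fun LS : 'M[R]_p * 'M[R]_p => LS.2 i j).
Proof.
move=> LS; apply: (@continuous_comp _ _ _ snd (fun A : 'M[R]_p => A i j)).
  exact: cvg_snd.
exact: coord_continuous.
Qed.

Lemma add_entry_continuous i j :
  continuous (fun LS : 'M[R]_p * 'M[R]_p => (LS.1 + LS.2) i j).
Proof.
under [X in continuous X]eq_fun do rewrite mxE.
move=> LS; apply: cvgD; first exact: fst_entry_continuous.
exact: snd_entry_continuous.
Qed.

Lemma fobj_continuous mu Sigma LS : 0 < \det (LS.1 + LS.2) ->
  {for LS, continuous (fobj mu Sigma)}.
Proof.
move=> d0; apply: cvgD.
  by apply: continuous_sum => i _; exact: fst_entry_continuous.
apply: cvgMl_tmp; apply: cvgB.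
  exact: (continuous_tr_mulr add_entry_continuous).
apply: (@continuous_comp _ _ _ (fun LS => \det (LS.1 + LS.2)) (@ln R)).
  exact: (continuous_det add_entry_continuous).
exact: continuous_ln.
Qed.

(** Symmetry and semidefiniteness are an intersection of closed conditions, one for each pair of
    indices and one for each vector. *)
Lemma psdmx_closed (f : 'M[R]_p * 'M[R]_p -> 'M[R]_p) :
  (forall i j, continuous (fun LS => f LS i j)) ->
  closed [set LS | psdmx (f LS)].
Proof.
move=> cf.
have -> : [set LS | psdmx (f LS)] =
    (\bigcap_(ij : 'I_p * 'I_p)
       [set LS | f LS ij.2 ij.1 - f LS ij.1 ij.2 = 0]) `&`
    (\bigcap_(x : 'cV[R]_p) [set LS | 0 <= bil (f LS) x x]).
  apply/seteqP; split=> [LS [/symmetricmxP sf pf]|LS [sf pf]]; split.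
  - by move=> ij _ /=; rewrite -{1}sf mxE subrr.
  - by move=> x _; exact: pf.
  - apply/symmetricmxP/matrixP => i j; rewrite mxE; apply/eqP.
    by rewrite -subr_eq0; apply/eqP; exact: (sf (i, j)).
  - by move=> x; exact: pf.
apply: closedI; apply: closed_bigI.
  move=> ij _; apply: (@preimage_closed _ _
    (fun LS => f LS ij.2 ij.1 - f LS ij.1 ij.2) [set 0]); last exact: closed_eq.
  by move=> LS _; apply: cvgB; exact: cf.
move=> x _; apply: (@preimage_closed _ _
  (fun LS => bil (f LS) x x) [set t | 0 <= t]).
  by move=> LS _; exact: continuous_bil.
exact: closed_ge.
Qed.

(* For a fixed set [Z] of positions where [S] is forced to vanish, the penalty
   is dominated by the constant [C * #|~: Z|], so it is enough to minimize the
   continuous part for each of the finitely many [Z]. *)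
Lemma compact_l0_min (K : set ('M[R]_p * 'M[R]_p))
    (f : 'M[R]_p * 'M[R]_p -> R) (C : R) : 0 <= C ->
  K !=set0 -> compact K -> {within K, continuous f} ->
  exists2 x, K x & forall y, K y ->
    f x + C * (l0norm x.2)%:R <= f y + C * (l0norm y.2)%:R.
Proof.
move=> C0 [x0 Kx0] cK cf.
pose V (Z : {set 'I_p * 'I_p}) : set ('M[R]_p * 'M[R]_p) :=
  \bigcap_(ij in [set` Z]) [set LS : 'M[R]_p * 'M[R]_p | LS.2 ij.1 ij.2 = 0].
pose zeros (S : 'M[R]_p) := [set ij | S ij.1 ij.2 == 0]%SET.
have Vzeros LS : V (zeros LS.2) LS by move=> ij /=; rewrite inE => /eqP.
have l0zeros S : l0norm S = #|~: zeros S|.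
  by apply: eq_card => ij; rewrite !inE.
have l0V Z LS : V Z LS -> (l0norm LS.2 <= #|~: Z|)%N.
  move=> VLS; rewrite l0zeros subset_leq_card // finset.setCS.
  by apply/fintype.subsetP => ij ijZ; rewrite inE; apply/eqP; exact: VLS.
have cV Z : compact (K `&` V Z).
  apply: compact_closedI => //; apply: closed_bigI => ij _.
  apply: (@preimage_closed _ _
    (fun LS : 'M[R]_p * 'M[R]_p => LS.2 ij.1 ij.2) [set 0]).
    by move=> LS _; exact: snd_entry_continuous.
  exact: closed_eq.
have min Z : exists x, K `&` V Z !=set0 ->
    (K `&` V Z) x /\ forall y, (K `&` V Z) y -> f x <= f y.
  (* If no point of [K] has this pattern, the claim is vacuous and [x0] is a default value. *)
  have [ne|] := pselect (K `&` V Z !=set0); last by exists x0.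
  have [|x] := @compact_EVT_min _ _ f _ ne (cV Z).
    by apply: continuous_subspaceW cf => LS [].
  move=> /set_mem Kx xmin; exists x => _; split=> // y Ky.
  exact/xmin/mem_set.
have {min}[m mP] := boolp.choice min.
pose F LS := f LS + C * (l0norm LS.2)%:R.
have nev y : K y -> K `&` V (zeros y.2) !=set0 by move=> Ky; exists y.
have i0 : `[<K `&` V (zeros x0.2) !=set0>] by apply/asboolP/nev.
(* Among the patterns met by [K], choose one whose minimizer has the least penalized value. *)
case: (@Order.TotalTheory.arg_minP _ _ _ (zeros x0.2)
  (fun Z => `[<K `&` V Z !=set0>]) (fun Z => F (m Z)) i0) => Z /asboolP nZ Zmin.
exists (m Z) => [|y Ky]; first by have [[]] := mP _ nZ.
have [[_ Vm] mmin] := mP _ (nev y Ky).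
(* The minimizer for the zero pattern of [y] vanishes wherever [y.2] does, so neither its value of
   [f] nor its penalty exceeds that of [y]. *)
apply: (le_trans (Zmin (zeros y.2) _)); first exact/asboolP/nev.
by rewrite lerD ?mmin // ler_wpM2l // ler_nat (l0zeros y.2) l0V.
Qed.

Lemma sublevel_bounds (C mu : R) Sigma (c : R) :
  (0 < p)%N -> 0 < C -> 0 < mu -> pdmx Sigma ->
  exists M, forall LS, feasible LS -> Fobj C mu Sigma LS <= c ->
    [/\ forall i j, `|LS.1 i j| <= M, forall i j, `|LS.2 i j| <= M
      & expR (- c / mu) <= \det (LS.1 + LS.2)].
Proof.
move=> p0 C0 mu0 pSigma; have s0 := pdmx_tr_gt0 p0 pSigma.
have [K KP] := fobj_ge_trace p0 mu0 pSigma.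
(* The trace bound solved for [\tr (L + S)]. Both traces are nonnegative, so each is at most this
   constant and bounds the entries. *)
exists ((c + K) / (mu / (2 * \tr Sigma))) => LS DLS Fc.
have fc := le_trans (fobj_le_Fobj mu Sigma LS C0) Fc.
have [pL pS pX] := DLS.
have trX : \tr (LS.1 + LS.2) <= (c + K) / (mu / (2 * \tr Sigma)).
  rewrite ler_pdivlMr ?divr_gt0 ?mulr_gt0 // mulrC -lerBlDr.
  exact: le_trans (KP _ DLS) fc.
have := trX; rewrite mxtraceD; have := psdmx_tr_ge0 pL.
have := psdmx_tr_ge0 pS => S0 L0 LSM; split=> [i j|i j|].
- by apply: (le_trans (psdmx_entry_le_tr i j pL)); lra.
- by apply: (le_trans (psdmx_entry_le_tr i j pS)); lra.
rewrite -[leRHS]lnK ?posrE ?pdmx_det_gt0 // ler_expR ler_pdivrMr //.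
have := le_trans (fobj_ge_ln_det p0 mu0 pSigma DLS) fc.
by rewrite mulNr lerNl mulrC.
Qed.

End Minimization.

(** * Existence and boundedness of the minimizers *)

Theorem theorem1 (R : realType) (p : nat) (hp : (0 < p)%N)
    (C mu : R) (hC : 0 < C) (hmu : 0 < mu)
    (Sigma : 'M[R]_p) (hSigma : pdmx Sigma) :
  minimizers (@feasible R p) (Fobj C mu Sigma) !=set0 /\
  bounded_set (minimizers (@feasible R p) (Fobj C mu Sigma)).
Proof.
(* A feasible reference point: every minimizer lies in the sublevel set at level [F x0]. *)
pose x0 : 'M[R]_p * 'M[R]_p := (1%:M, 0).
have Dx0 : feasible x0.
  split; [exact: psdmx1|exact: psdmx0|rewrite addr0].
  by apply: (psdmx_det_pd psdmx1); rewrite det1 oner_neq0.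
set F := Fobj C mu Sigma.
have [M MP] := sublevel_bounds (F x0) hp hC hmu hSigma.
split; last first.
  exists M; split; first exact: num_real.
  move=> N MN LS [DLS LSmin]; have [L S _] := MP _ DLS (LSmin _ Dx0).
  (* The matrix norm is a maximum taken together with 0, so [N] must also dominate 0; the bound on a
     diagonal entry shows it. *)
  have N0 : 0 <= N.
    by apply: le_trans (ltW MN); apply: le_trans (L (Ordinal hp) (Ordinal hp)).
  have le_norm (A : 'M[R]_p) : (forall i j, `|A i j| <= M) -> `|A| <= N.
    move=> AM; rewrite /Num.norm /= mx_normrE.
    apply/bigmax_leP; split=> // ij _; exact: le_trans (AM _ _) (ltW MN).
  by rewrite /= [leLHS]prod_normE ge_max !le_norm.
pose delta := expR (- F x0 / mu).
pose box : set 'M[R]_p := [set A | forall i j, `|A i j| <= M].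
(* The bound [delta] on the determinant makes [K] closed while forcing [L + S] to be positive
   definite on it. *)
pose K : set ('M[R]_p * 'M[R]_p) := (box `*` box) `&`
  ([set LS | psdmx LS.1] `&` ([set LS | psdmx LS.2] `&`
   [set LS | delta <= \det (LS.1 + LS.2)])).
have KD LS : K LS -> feasible LS.
  move=> [_ [pL [pS dX]]]; split=> //; apply: psdmx_det_pd; first exact: psdmxD.
  by rewrite gt_eqF // (lt_le_trans (expR_gt0 _) dX).
have DK LS : feasible LS -> F LS <= F x0 -> K LS.
  by move=> DLS /(MP _ DLS)[L S d]; have [pL pS _] := DLS.
have cK : compact K.
  apply: compact_closedI.
    by apply: compact_setX; exact: compact_mx_box.
  apply: closedI; first exact/psdmx_closed/fst_entry_continuous.
  apply: closedI; first exact/psdmx_closed/snd_entry_continuous.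
  apply: (@preimage_closed _ _
    (fun LS : 'M[R]_p * 'M[R]_p => \det (LS.1 + LS.2)) [set t | delta <= t]).
    by move=> LS _; exact: (continuous_det add_entry_continuous).
  exact: closed_ge.
have cf : {within K, continuous (fobj mu Sigma)}.
  apply: continuous_in_subspaceT => LS /set_mem /KD [_ _ /pdmx_det_gt0].
  exact: fobj_continuous.
have Kx0 : K x0 by exact: DK.
have [|x Kx xmin] := compact_l0_min (ltW hC) _ cK cf; first by exists x0.
exists x; split=> [|y Dy]; first exact: KD.
(* A feasible [y] above level [F x0] may lie outside [K], but the minimum over [K] is at most
   [F x0]. *)
have [/(DK _ Dy)/xmin//|/ltW] := leP (F y) (F x0).
exact: le_trans (xmin _ Kx0).
Qed.
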